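(* Let $X$ be completely regular. If $(\mu_\alpha)$ satisfies a large deviation principle with powers $(t_\alpha)$, then the rate function $J$ is given by $$J(x)=\sup_{h\in\mathcal{C}(X)_-}\{h(x)-\Lambda(h)\}=\sup_{h\in\mathcal{C}(X)}\{h(x)-\overline{\Lambda}(h)\}=\sup_{h\in\mathcal{C}(X)}\{h(x)-\underline{\Lambda}(h)\}=\sup_{h\in\mathcal{C}(X)}\{h(x)-\lim_{M\to+\infty}\underline{\Lambda}(h_M)\}\quad\text{for all }x\in X.$$ If moreover $(\mu_\alpha)$ is exponentially tight with respect to $(t_\alpha)$, then, for any set $\mathcal{A}$ of real-valued continuous functions on $X$ which is either an algebra separating the points or a well-separating class, one can replace $\mathcal{C}(X)$ by $\mathcal{A}$ in the last two equalities above, and $\mathcal{C}(X)_-$ by $\mathcal{A}_{ba}$ (resp. by $\mathcal{A}_-$ when $\mathcal{A}$ does not vanish identically at any point of $X$) in the first equality; that is, for all $x\in X$, $$J(x)=\sup_{h\in\mathcal{A}_{ba}}\{h(x)-\Lambda(h)\}=\sup_{h\in\mathcal{A}}\{h(x)-\underline{\Lambda}(h)\}=\sup_{h\in\mathcal{A}}\{h(x)-\lim_{M\to+\infty}\underline{\Lambda}(h_M)\},$$ and $J(x)=\sup_{h\in\mathcal{A}_-}\{h(x)-\Lambda(h)\}$ when $\mathcal{A}$ does not vanish identically at any point of $X$.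
   Context: $X$ is a topological space, not reduced to one point, in which compact sets are Borel sets; ''completely regular'' does not include Hausdorff. $\mathcal{C}(X)$ is the set of real-valued continuous functions on $X$. $(\mu_\alpha)$ is a net of Borel probability measures on $X$ and $(t_\alpha)$ a net (same index set) in $]0,+\infty[$ converging to $0$. Write $\mu_\alpha^{t_\alpha}(A)=(\mu_\alpha(A))^{t_\alpha}$ for Borel $A$, and for Borel measurable $h:X\to[-\infty,+\infty[$, $\mu_\alpha^{t_\alpha}(e^{h/t_\alpha})=\big(\int_X e^{h(x)/t_\alpha}\mu_\alpha(dx)\big)^{t_\alpha}$. Put $\overline\Lambda(h)=\log\limsup\mu_\alpha^{t_\alpha}(e^{h/t_\alpha})$, $\underline\Lambda(h)=\log\liminf\mu_\alpha^{t_\alpha}(e^{h/t_\alpha})$, and $\Lambda(h)=\log\lim\mu_\alpha^{t_\alpha}(e^{h/t_\alpha})$ when this limit exists (in $[-\infty,+\infty]$ for $\Lambda(h)$); wherever $\Lambda(h)$ appears in the claim, its existence is part of the assertion. Conventions: $e^{-\infty}=0$, $\log0=-\infty$. Large deviation principle with powers $(t_\alpha)$: for a function $l:X\to[0,+\infty]$, $\limsup\mu_\alpha^{t_\alpha}(F)\le\sup_{x\in F}e^{-l(x)}$ for all closed $F$ and $\sup_{x\in G}e^{-l(x)}\le\liminf\mu_\alpha^{t_\alpha}(G)$ for all open $G$; the lower regularization of $l$ (the greatest lower semi-continuous function $\le l$) is then called a rate function (it is unique when $X$ is regular). $(\mu_\alpha)$ is exponentially tight with respect to $(t_\alpha)$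 if for each $\varepsilon>0$ there is a compact $K\subset X$ with $\limsup\mu_\alpha^{t_\alpha}(X\setminus K)<\varepsilon$. Algebras are real algebras under pointwise operations, not necessarily unital. A set $\mathcal{A}\subset\mathcal{C}(X)$ separates the points if for all $x\neq y$ there is $h\in\mathcal{A}$ with $h(x)\ne h(y)$; it does not vanish identically at any point if for every $x$ there is $h\in\mathcal{A}$ with $h(x)\ne0$. A well-separating class is a set $\mathcal{A}\subset\mathcal{C}(X)$ which contains the constants, is closed under finite pointwise minima, and such that for all $x\neq y$ in $X$ and $a,b\in\mathbb{R}$ there is $g\in\mathcal{A}$ with $g(x)=a$, $g(y)=b$. $\mathcal{A}_{ba}$ is the set of bounded-above elements of $\mathcal{A}$; $\mathcal{A}_-=\{h\in\mathcal{A}:h\le0\}$, and likewise $\mathcal{C}(X)_-$. For real $M$, $h_M=h1_{\{h<M\}}-\infty1_{\{h\ge M\}}$ (i.e. $h_M=h$ on $\{h<M\}$ and $-\infty$ elsewhere). *)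

(* Defs.v *)
From HB Require Import structures.
From mathcomp Require Import all_boot all_order all_algebra.
From mathcomp Require Import all_classical all_reals all_analysis.
Import Order.TTheory GRing.Theory Num.Theory.
Import numFieldNormedType.Exports.

Set Implicit Arguments.
Unset Strict Implicit.
Unset Printing Implicit Defensive.

Local Open Scope classical_set_scope.
Local Open Scope ring_scope.
Local Open Scope ereal_scope.

Definition borel (X : ptopologicalType) := g_sigma_algebraType (@open X).

Definition directed (I : Type) (le : I -> I -> Prop) : Prop :=
  [/\ inhabited I,
      forall a, le a a,
      forall a b c, le a b -> le b c -> le a c
    & forall a b, exists2 c, le a c & le b c].

Section nets.
Context {R : realType} {I : Type} (le : I -> I -> Prop).

Definition tails : set_system I :=
  [set S : set I | exists a, forall b, le a b -> S b].

(* [limf_esup] and [limf_einf] require the index type to carry a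
   [filteredType] structure, which an arbitrary directed set does not. *)
Definition net_limsup (u : I -> \bar R) : \bar R :=
  ereal_inf [set ereal_sup [set u b | b in le a] | a in [set: I]].

Definition net_liminf (u : I -> \bar R) : \bar R :=
  ereal_sup [set ereal_inf [set u b | b in le a] | a in [set: I]].

End nets.

Section large_deviations.
Context {R : realType} {X : ptopologicalType} {I : Type}.
Variables (le : I -> I -> Prop).
Variables (mu : I -> probability (borel X) R) (t : I -> R).

Definition mupow (A : set X) (a : I) : \bar R := mu a A `^ t a.

Definition mupow_exp (h : X -> \bar R) (a : I) : \bar R :=
  (\int[mu a]_x expeR (h x * ((t a)^-1)%:E)) `^ t a.

Definition Lambda_sup (h : X -> \bar R) : \bar R :=
  lne (net_limsup le (mupow_exp h)).

Definition Lambda_inf (h : X -> \bar R) : \bar R :=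
  lne (net_liminf le (mupow_exp h)).

Definition Lambda_exists (h : X -> \bar R) : Prop :=
  cvg (mupow_exp h @ tails le).

(* Meaningful only under [Lambda_exists h]. *)
Definition Lambda (h : X -> \bar R) : \bar R :=
  lne (lim (mupow_exp h @ tails le)).

(* The supremum is taken in [0, +oo], so that it is 0 (and not -oo) over the
   empty set. *)
Definition sup_expN (l : X -> \bar R) (A : set X) : \bar R :=
  ereal_sup (0 |` [set expeR (- l x) | x in A]).

Definition ldp (l : X -> \bar R) : Prop :=
  [/\ forall x, 0 <= l x,
      forall F : set X, closed F -> net_limsup le (mupow F) <= sup_expN l F
    & forall G : set X, open G -> sup_expN l G <= net_liminf le (mupow G)].

Definition lower_regularization (l J : X -> \bar R) : Prop :=
  [/\ lower_semicontinuous J,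
      forall x, J x <= l x
    & forall k : X -> \bar R, lower_semicontinuous k ->
        (forall x, k x <= l x) -> forall x, k x <= J x].

Definition ldp_rate_function (J : X -> \bar R) : Prop :=
  exists2 l, ldp l & lower_regularization l J.

Definition exponentially_tight : Prop :=
  forall e : R, (0 < e)%R ->
    exists2 K : set X, compact K & net_limsup le (mupow (~` K)) < e%:E.

End large_deviations.

Section function_classes.
Context {R : realType} {X : ptopologicalType}.
Implicit Types (A : set (X -> R)) (h : X -> R).

Definition continuous_functions : set (X -> R) := [set h | continuous h].

Definition nonpositive_part A : set (X -> R) :=
  [set h | A h /\ forall x, (h x <= 0)%R].

Definition bounded_above_part A : set (X -> R) :=
  [set h | A h /\ exists c : R, forall x, (h x <= c)%R].

Definition real_algebra A : Prop :=
  [/\ A (cst 0%R),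
      forall f g, A f -> A g -> A (f \+ g)%R,
      forall (c : R) f, A f -> A (c \*o f)%R
    & forall f g, A f -> A g -> A (f \* g)%R].

Definition separates_points A : Prop :=
  forall x y : X, x <> y -> exists2 h, A h & h x <> h y.

Definition vanishes_nowhere A : Prop :=
  forall x : X, exists2 h, A h & h x <> 0%R.

Definition well_separating A : Prop :=
  [/\ forall c : R, A (cst c),
      forall f g, A f -> A g -> A (f \min g)%O
    & forall (x y : X) (a b : R), x <> y ->
        exists2 g, A g & g x = a /\ g y = b].

Definition truncated (h : X -> \bar R) (M : R) : X -> \bar R :=
  fun x => if h x < M%:E then h x else -oo.

Definition conjugate_on A (L : (X -> \bar R) -> \bar R) (x : X) : \bar R :=
  ereal_sup [set (h x)%:E - L (EFin \o h) | h in A].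

End function_classes.

(* The argument of the limit is nondecreasing in [M]. *)
Definition Lambda_inf_trunc {R : realType} {X : ptopologicalType} {I : Type}
    (le : I -> I -> Prop) (mu : I -> probability (borel X) R) (t : I -> R)
    (h : X -> \bar R) : \bar R :=
  lim (Lambda_inf le mu t (truncated h M) @[M --> +oo%R]).

(* Main.v *)
Require Import Defs.
From mathcomp Require Import all_boot all_order all_algebra.
From mathcomp Require Import all_classical all_reals all_analysis.
From mathcomp Require Import measurable_realfun lra.
Import Order.TTheory GRing.Theory Num.Theory.
Import numFieldNormedType.Exports.

Local Open Scope classical_set_scope.
Local Open Scope ring_scope.
Local Open Scope ereal_scope.

(** Write [Lam] for the logarithmic functionals.  Integrating over a small open
    set where [h] is close to [h x] gives the lower Varadhan bound
    [h x - J x <= Lam_inf h_M] for every continuous [h] and every [M > h x];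
    hence each of the suprema in the statement is at most [J].  If [h] is
    bounded above, slicing the range of [h] into finitely many closed level
    bands gives the matching bound [Lam_sup h <= sup (h - J)]; in particular
    [Lam h] exists.

    For the reverse inequality at [x] it suffices, for every real [a < J x],
    to find [h] in the class with [h - J <= h x - a] everywhere.  In a completely
    regular space take [h] nonpositive, with [h x = 0] and [h = - `|a|] off the
    open set [{J > a}].  Under exponential tightness, [J >= a] off some compact
    [K], so it is enough that [h] peaks at [x] and drops by [a] on the compact
    set [K `\` {J > a}].  In an algebra such an [h] is minus a finite sum of
    squares of elements vanishing at [x], and in a well-separating class it is
    a finite minimum, so no Stone-Weierstrass approximation is needed. *)

(** * Upper and lower limits along a directed set *)

Section nets.
Context {R : realType} {I : Type} {le : I -> I -> Prop}.
Hypothesis le_dir : directed le.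
Implicit Types (u v : I -> \bar R) (c : \bar R).

Lemma tails_proper_filter : ProperFilter (tails le).
Proof.
case: le_dir => -[i0] refl trans ub; apply: Build_ProperFilter_ex => [S [a aS]|].
  by exists a; exact/aS/refl.
split=> [|P Q [a aP] [b bQ]|P Q PQ [a aP]]; first by exists i0.
- have [c ac bc] := ub a b; exists c => d cd.
  by split; [apply: aP; exact: trans cd|apply: bQ; exact: trans cd].
- by exists a => b /aP /PQ.
Qed.
Local Existing Instance tails_proper_filter.

Lemma near_lt_net_limsup u c : net_limsup le u < c ->
  \forall a \near tails le, u a < c.
Proof.
move=> /ereal_inf_lt[_ [a _ <-] supc]; exists a => b ab.
by apply: le_lt_trans supc; apply: ereal_sup_ubound; exists b.
Qed.

Lemma near_gt_net_liminf u c : c < net_liminf le u ->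
  \forall a \near tails le, c < u a.
Proof.
move=> /ereal_sup_gt[_ [a _ <-] infc]; exists a => b ab.
by apply: lt_le_trans infc _; apply: ereal_inf_lbound; exists b.
Qed.

Lemma net_limsup_le_near u c : (\forall a \near tails le, u a <= c) ->
  net_limsup le u <= c.
Proof.
move=> [a auc]; apply: le_trans (ereal_inf_lbound _) _; first by exists a.
by apply: ge_ereal_sup => _ [b ab <-]; exact: auc.
Qed.

Lemma net_liminf_ge_near u c : (\forall a \near tails le, c <= u a) ->
  c <= net_liminf le u.
Proof.
move=> [a auc]; apply: le_trans (ereal_sup_ubound _); last by exists a.
by apply: le_ereal_inf_tmp => _ [b ab <-]; exact: auc.
Qed.

Lemma le_net_liminf u v : (forall a, u a <= v a) ->
  net_liminf le u <= net_liminf le v.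
Proof.
move=> uv; apply: ge_ereal_sup => _ [a _ <-].
apply: net_liminf_ge_near; exists a => b ab; apply: le_trans (uv b).
by apply: ereal_inf_lbound; exists b.
Qed.

Lemma le_net_liminf_limsup u : net_liminf le u <= net_limsup le u.
Proof.
case: le_dir => _ _ _ ub.
apply: ge_ereal_sup => _ [a _ <-]; apply: le_ereal_inf_tmp => _ [b _ <-].
have [c ac bc] := ub a b.
apply: (@le_trans _ _ (u c)).
  by apply: ereal_inf_lbound; exists c.
by apply: ereal_sup_ubound; exists c.
Qed.

(** Eventually [u] lies below each number above its limsup and above each number below its liminf.
    The hypothesis lets the limsup serve on both sides; as it may be infinite, three cases arise. *)
Lemma net_cvg u : net_limsup le u <= net_liminf le u ->
  u @ tails le --> net_limsup le u.
Proof.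
move=> sup_le_inf.
have su c : net_limsup le u < c -> \forall a \near tails le, u a < c.
  exact: near_lt_net_limsup.
have iu c : c < net_limsup le u -> \forall a \near tails le, c < u a.
  by move=> /lt_le_trans/(_ sup_le_inf)/near_gt_net_liminf.
case: (net_limsup le u) su iu => [r| |] su iu.
- apply/fine_cvgP; split.
    have h1 := su (r + 1)%:E; have h2 := iu (r - 1)%:E.
    apply: filterS2 (h1 _) (h2 _) => [a /= ua au| |].
    + by rewrite fin_numElt (lt_trans _ au) ?ltNyr// (lt_trans ua) ?ltry.
    + by rewrite lte_fin ltrDl.
    + by rewrite lte_fin gtrBl.
  apply/cvgrPdist_lt => e e0.
  have h1 := su (r + e)%:E; have h2 := iu (r - e)%:E.
  apply: filterS2 (h1 _) (h2 _) => [a /= ua au| |].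
  + move: (u a) ua au => [s| |]//=; rewrite !lte_fin => h h'.
    by rewrite distrC ltr_distl h h'.
  + by rewrite lte_fin ltrDl.
  + by rewrite lte_fin gtrBl.
- by apply/cvgeyPgt => A; apply: iu; rewrite ltry.
- by apply/cvgeNyPlt => A; apply: su; rewrite ltNyr.
Qed.

End nets.

(** * Extended exponential, logarithm and powers *)

Section ereal_exp_ln.
Context {R : realType}.
Implicit Types (x y : \bar R).

Lemma le_lneP x y : 0 <= y -> (expeR x <= y) = (x <= lne y).
Proof. by move=> y0; rewrite -[in RHS]lee_expeR lneK// in_itv/= y0 leey. Qed.

Lemma lne_leP x y : 0 <= y -> (y <= expeR x) = (lne y <= x).
Proof. by move=> y0; rewrite -[in RHS]lee_expeR lneK// in_itv/= y0 leey. Qed.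

Lemma le_lne x y : 0 <= x -> x <= y -> lne x <= lne y.
Proof.
by move=> x0 xy; rewrite lee_lne// in_itv/= ?x0 ?(le_trans x0 xy) leey.
Qed.

Lemma le_poweR (r : R) x y : (0 <= r)%R -> 0 <= x -> x <= y ->
  x `^ r <= y `^ r.
Proof.
move=> r0 x0 xy; apply: gt0_ler_poweR => //.
  by rewrite in_itv/= x0 leey.
by rewrite in_itv/= (le_trans x0 xy) leey.
Qed.

Lemma poweR_expeR (s r : R) : expeR s%:E `^ r = expeR (s * r)%:E.
Proof. by rewrite /= expRM. Qed.

(** Trades [h x - J x <= L] for [h x - L <= J x] when [J x] and [L] may be infinite. *)
Lemma lee_subl_swap (r : R) x y : 0 <= x -> (r%:E - x <= y) = (r%:E - y <= x).
Proof.
by move: x y => [x| |] [y| |]//= x0; rewrite ?leNye ?leey// !lee_fin; lra.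
Qed.

End ereal_exp_ln.

(** * Monotone integrals and Borel sets *)

Section integral.
Context d (T : measurableType d) (R : realType) (mu : {measure set T -> \bar R}).
Implicit Types f g : T -> \bar R.

(* The integral of a nonnegative function is a supremum over the simple functions
   below it, so monotonicity needs no measurability, even for truncations. *)
Lemma ge0_le_integral_nonmeasurable f g : (forall x, 0 <= f x) ->
  (forall x, f x <= g x) -> \int[mu]_x f x <= \int[mu]_x g x.
Proof.
move=> f0 fg; have g0 x : 0 <= g x := le_trans (f0 x) (fg x).
rewrite !ge0_integralTE//; apply: ereal_sup_le => _ [h hf <-].
by exists h => // x; exact: le_trans (fg x).
Qed.

End integral.

Lemma open_measurable_borel {X : ptopologicalType} (U : set X) :
  open U -> measurable (U : set (borel X)).
Proof. exact: sub_sigma_algebra. Qed.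

Lemma closed_measurable_borel {X : ptopologicalType} (F : set X) :
  closed F -> measurable (F : set (borel X)).
Proof.
move=> cF; rewrite -(setCK F); apply: measurableC.
by apply: open_measurable_borel; rewrite openC.
Qed.

(** * Exponential integrals raised to the power [t a] *)

Section exponential_integrals.
Context {R : realType} {X : ptopologicalType} {I : Type} {le : I -> I -> Prop}.
Variables (mu : I -> probability (borel X) R) (t : I -> R).
Hypothesis le_dir : directed le.
Hypothesis t_gt0 : forall a, (0 < t a)%R.
Implicit Types (A F G : set X) (h g : X -> \bar R) (a : I).
#[local] Instance tails_filter : ProperFilter (tails le) :=
  tails_proper_filter le_dir.

Lemma le_mupow_exp h g a : (forall x, h x <= g x) ->
  mupow_exp mu t h a <= mupow_exp mu t g a.
Proof.
move=> hg; apply: le_poweR; first exact: ltW.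
  by apply: integral_ge0 => x _; exact: expeR_ge0.
apply: ge0_le_integral_nonmeasurable => x; first exact: expeR_ge0.
by rewrite lee_expeR lee_wpmul2r// lee_fin invr_ge0 ltW.
Qed.

(** Markov's inequality: [expeR (r / t a)] times the indicator of [G] is below the integrand, and
    the power [t a] turns that factor into [expeR r]. *)
Lemma mupow_exp_ge_on (r : R) h G a : measurable (G : set (borel X)) ->
  (forall x, G x -> r%:E <= h x) ->
  expeR r%:E * mupow mu t G a <= mupow_exp mu t h a.
Proof.
move=> mG rh; have t0 := t_gt0 a.
rewrite -(mulfVK (lt0r_neq0 t0) r) -poweR_expeR -poweRM//; last exact: expeR_ge0.
apply: le_poweR; first exact: ltW.
  by rewrite mule_ge0// expeR_ge0.
have -> : mu a G = \int[mu a]_x (\1_G x)%:E by rewrite integral_indic// setIT.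
rewrite [expeR _]/= -ge0_integralZl_EFin//; last first.
  by apply/measurable_EFinP; exact: measurable_indic.
apply: ge0_le_integral_nonmeasurable => x.
  by rewrite mule_ge0// lee_fin expR_ge0.
rewrite indicE; case: (boolP (x \in G)) => [|_]; last by rewrite mule0 expeR_ge0.
rewrite inE => Gx; rewrite mule1 -[leLHS]/(expeR (r / t a)%:E) lee_expeR EFinM.
by rewrite lee_wpmul2r ?rh// lee_fin invr_ge0 ltW.
Qed.

Lemma measure_le_of_mupow A a (r : R) : mupow mu t A a <= expeR r%:E ->
  mu a A <= (expR (r / t a))%:E.
Proof.
move=> Ar; have t0 := t_gt0 a.
rewrite -[leLHS]poweRe1// -(mulfV (lt0r_neq0 t0)) poweRrM.
rewrite -[leRHS]/(expeR (r / t a)%:E) -poweR_expeR.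
by apply: le_poweR => //; [rewrite invr_ge0 ltW|exact: poweR_ge0].
Qed.

Lemma net_liminf_ge0 (u : I -> \bar R) : (forall a, 0 <= u a) ->
  0 <= net_liminf le u.
Proof.
by move=> u0; apply: net_liminf_ge_near; exact: nearW.
Qed.

Lemma net_limsup_ge0 (u : I -> \bar R) : (forall a, 0 <= u a) ->
  0 <= net_limsup le u.
Proof.
by move=> u0; rewrite (le_trans (net_liminf_ge0 _ u0))// le_net_liminf_limsup.
Qed.

Lemma le_Lambda_inf h g : (forall x, h x <= g x) ->
  Lambda_inf le mu t h <= Lambda_inf le mu t g.
Proof.
move=> hg; apply: le_lne.
  by apply: net_liminf_ge0 => a; exact: poweR_ge0.
by apply: le_net_liminf => a; exact: le_mupow_exp.
Qed.

Lemma Lambda_inf_le_sup h : Lambda_inf le mu t h <= Lambda_sup le mu t h.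
Proof.
apply: le_lne; last exact: le_net_liminf_limsup.
by apply: net_liminf_ge0 => a; exact: poweR_ge0.
Qed.

Lemma mule_net_liminf (k : R) (u v : I -> \bar R) : (0 < k)%R ->
  (forall a, k%:E * u a <= v a) -> k%:E * net_liminf le u <= net_liminf le v.
Proof.
move=> k0 kuv; rewrite -lee_pdivlMl//; apply: ge_ereal_sup => _ [a _ <-].
rewrite lee_pdivlMl//; apply: net_liminf_ge_near; exists a => b ab.
apply: le_trans (kuv b); rewrite lee_pmul2l//.
by apply: ereal_inf_lbound; exists b.
Qed.

(** * Lower and upper Varadhan bounds *)

Section varadhan.
Variable J : X -> \bar R.

Lemma Lambda_inf_truncated_ge (h : X -> R) x (M : R) :
  (forall G, open G -> sup_expN J G <= net_liminf le (mupow mu t G)) ->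
  continuous h -> (h x < M)%R ->
  (h x)%:E - J x <= Lambda_inf le mu t (truncated (EFin \o h) M).
Proof.
move=> lowerJ hc hM; apply/lee_addgt0Pr => e e0.
suff : (h x - e)%:E - J x <= Lambda_inf le mu t (truncated (EFin \o h) M).
  by rewrite EFinB addeAC leeBlDr.
(* On [G] the truncation is inactive because [h < M], and [h] exceeds [h x - e]. *)
pose G := h @^-1` `](h x - e)%R, M[%classic.
have oG : open G by apply: open_comp => // y _; exact: hc.
have Gx : G x by rewrite /G /= in_itv/= hM andbT ltrBlDr ltrDl.
rewrite -le_lneP; last by apply: net_liminf_ge0 => a; exact: poweR_ge0.
rewrite expeRD; apply: (@le_trans _ _
    (expeR (h x - e)%:E * net_liminf le (mupow mu t G))).
  rewrite lee_wpmul2l ?expeR_ge0//; apply: le_trans (lowerJ _ oG).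
  by apply: ereal_sup_ubound; right; exists x.
apply: mule_net_liminf => [|a]; first exact: expR_gt0.
apply: mupow_exp_ge_on => [|y]; first exact: open_measurable_borel.
rewrite /G /= in_itv/= => /andP[hy yM].
by rewrite /truncated /= lte_fin yM lee_fin ltW.
Qed.

(** Bands of height [e] are cut downward from [c]. Above the lowest level, the band of index
    [truncn ((c - h x) / e)] contains [h x] and its term alone suffices; below it, the final
    constant does. *)
Lemma step_majorant (h : X -> R) (c e s : R) (n : nat) x :
  (0 < e)%R -> (0 < s)%R -> (h x <= c)%R ->
  expeR ((h x)%:E * (s^-1)%:E) <=
  \sum_(i < n) (expR ((c - i%:R * e) / s))%:E *
     (\1_[set y | c - i.+1%:R * e <= h y <= c - i%:R * e]%R x)%:E
  + (expR ((c - n%:R * e) / s))%:E.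
Proof.
move=> e0 s0 hc; set S := \sum_(i < n) _.
have S0 : 0 <= S.
  by apply: sume_ge0 => i _; rewrite mule_ge0// lee_fin expR_ge0.
have [hn|nh] := leP (h x) (c - n%:R * e)%R.
  rewrite (@le_trans _ _ (expR ((c - n%:R * e) / s))%:E)//.
    by rewrite /= lee_fin ler_expR ler_pM2r// invr_gt0.
  by rewrite leeDr.
have k0 : (0 <= (c - h x) / e)%R by rewrite divr_ge0 ?subr_ge0// ltW.
have kn : (Num.truncn ((c - h x) / e) < n)%N.
  by rewrite truncn_lt_nat// ltr_pdivrMr//; lra.
have /andP[lk ku] := truncn_itv k0.
rewrite (@le_trans _ _ S)//; last by rewrite leeDl// lee_fin expR_ge0.
rewrite /S (bigD1 (Ordinal kn))//=.
apply: (@le_trans _ _ (expR ((c - (Num.truncn ((c - h x) / e))%:R * e) / s))%:E).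
  rewrite lee_fin ler_expR ler_pM2r ?invr_gt0//.
  by move: lk; rewrite ler_pdivlMr//; lra.
rewrite indicE mem_set/=; last first.
  move: lk ku; rewrite ler_pdivlMr// ltr_pdivrMr// => lk ku.
  by apply/andP; split; lra.
rewrite mule1 leeDl//.
by apply: sume_ge0 => i _; rewrite mule_ge0// lee_fin expR_ge0.
Qed.

(* The slack [3e] consists of the width of a level band, the gap between the
   limsup of [mupow F] and its eventual bound, and the factor [n + 1] counting the
   bands, which is eventually at most [exp (e / t a)]. *)
Lemma net_limsup_mupow_exp_le (h : X -> R) (c b e : R) :
  (forall F, closed F -> net_limsup le (mupow mu t F) <= sup_expN J F) ->
  t @ tails le --> (0 : R)%R ->
  continuous h -> (forall x, h x <= c)%R -> (0 < e)%R ->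
  (forall x, (h x)%:E - J x <= b%:E) ->
  net_limsup le (mupow_exp mu t (EFin \o h)) <= expeR (b + e *+ 3)%:E.
Proof.
move=> upperJ t_cvg0 hcont hc e0 hJb.
(* Enough bands of height [e] to descend from [c] to at most [b]. *)
pose n := (Num.truncn `|(c - b) / e|%R).+1.
have nb : (c - n%:R * e <= b)%R.
  have : ((c - b) / e < n%:R)%R.
    by rewrite (le_lt_trans (ler_norm _))// truncnS_gt.
  by rewrite ltr_pdivrMr//; lra.
pose F (i : nat) := [set y | c - i.+1%:R * e <= h y <= c - i%:R * e]%R.
have cF i : closed (F i).
  rewrite (_ : F i = h @^-1` `[(c - i.+1%:R * e)%R, (c - i%:R * e)%R]%classic).
    by apply: preimage_closed => [y _|]; [exact: hcont|exact: interval_closed].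
  by apply/seteqP; split=> y; rewrite /F /= in_itv.
have mF i : measurable (F i : set (borel X)) by exact: closed_measurable_borel.
(* On [F i], [J >= h - b >= c - (i + 1) * e - b], which costs one [e]; the second [e] makes the
   bound on the limsup strict, hence eventual. *)
have nearF : \forall a \near tails le, forall i : 'I_n,
    mupow mu t (F i) a <= expeR (b - (c - i%:R * e) + e *+ 2)%:E.
  apply: filter_forall => i.
  have : net_limsup le (mupow mu t (F i)) < expeR (b - (c - i%:R * e) + e *+ 2)%:E.
    apply: (@le_lt_trans _ _ (expeR (b - (c - i%:R * e) + e)%:E)); last first.
      by rewrite lte_expeR lte_fin; lra.
    apply: le_trans (upperJ _ (cF i)) _; apply: ge_ereal_sup => _ [->|[y Fy <-]].
      exact: expeR_ge0.
    rewrite lee_expeR; move: (hJb y) Fy.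
    case: (J y) => [j| |]; rewrite /F /= ?leNye ?leey// !lee_fin.
    by move=> ? /andP[+ _]; rewrite -natr1; lra.
  by move=> /near_lt_net_limsup; apply: filterS => a /ltW.
have neart : \forall a \near tails le, (n.+1%:R <= e / t a)%R.
  have e'0 : (0 < e / n.+1%:R)%R by rewrite divr_gt0.
  apply: filterS (cvgr0_norm_lt _ t_cvg0 _ e'0) => a; rewrite gtr0_norm//.
  by rewrite ltr_pdivlMr// ler_pdivlMr// mulrC => /ltW.
apply: net_limsup_le_near; apply: filterS2 nearF neart => a nearF neart.
have t0 := t_gt0 a.
rewrite -(mulfVK (lt0r_neq0 t0) (b + e *+ 3)%R) -poweR_expeR.
apply: le_poweR; [exact: ltW|by apply: integral_ge0 => x _; exact: expeR_ge0|].
have mterm i : measurable_fun [set: borel X]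
    (fun x => (expR ((c - i%:R * e) / t a))%:E * (\1_(F i) x)%:E : \bar R).
  by apply: measurable_funeM; apply/measurable_EFinP; exact: measurable_indic.
have term0 i x : 0 <= (expR ((c - i%:R * e) / t a))%:E * (\1_(F i) x)%:E :> \bar R.
  by rewrite mule_ge0// lee_fin expR_ge0.
apply: (@le_trans _ _ (\int[mu a]_x
    (\sum_(i < n) (expR ((c - i%:R * e) / t a))%:E * (\1_(F i) x)%:E
     + (expR ((c - n%:R * e) / t a))%:E))).
  apply: ge0_le_integral_nonmeasurable => x; first exact: expeR_ge0.
  exact: step_majorant.
rewrite ge0_integralD//; last 2 first.
- by move=> x _; exact: sume_ge0.
- exact: emeasurable_sum.
rewrite ge0_integral_sum// integral_cst//.
rewrite [X in _ + _ * X](_ : _ = 1); last exact: probability_setT.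
rewrite mule1.
(* The level [c - i * e] of each band cancels against the exponent in [nearF], so [K] bounds every
   term of the sum; it bounds the constant too, by [nb]. *)
set K := (expR ((b + e *+ 2) / t a))%:E.
have le_term (i : 'I_n) :
    \int[mu a]_x ((expR ((c - i%:R * e) / t a))%:E * (\1_(F i) x)%:E) <= K.
  rewrite ge0_integralZl_EFin//; last first.
    by apply/measurable_EFinP; exact: measurable_indic.
  rewrite integral_indic// setIT.
  apply: le_trans (lee_wpmul2l _ (measure_le_of_mupow _ _ _ (nearF i))) _.
    by rewrite lee_fin expR_ge0.
  by rewrite -EFinM -expRD lee_fin ler_expR -mulrDl ler_pM2r ?invr_gt0//; lra.
apply: (@le_trans _ _ (\sum_(i < n) K + K)).
  apply: leeD; first exact: lee_sum.
  by rewrite lee_fin ler_expR ler_pM2r ?invr_gt0//; lra.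
rewrite sumEFin -EFinD lee_fin sumr_const card_ord -mulrSr -mulr_natl.
have -> : ((b + e *+ 3) / t a = e / t a + (b + e *+ 2) / t a)%R.
  by rewrite -mulrDl; congr (_ / _)%R; lra.
rewrite expRD ler_pM2r ?expR_gt0// (le_trans neart)//.
by rewrite (le_trans _ (expR_ge1Dx _))// lerDr.
Qed.

Lemma Lambda_sup_le (h : X -> R) (c : R) (L : \bar R) :
  (forall F, closed F -> net_limsup le (mupow mu t F) <= sup_expN J F) ->
  t @ tails le --> (0 : R)%R ->
  continuous h -> (forall x, h x <= c)%R ->
  (forall x, (h x)%:E - J x <= L) ->
  Lambda_sup le mu t (EFin \o h) <= L.
Proof.
move=> upperJ t_cvg0 hcont hc hJL.
have sup0 : 0 <= net_limsup le (mupow_exp mu t (EFin \o h)).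
  by apply: net_limsup_ge0 => a; exact: poweR_ge0.
have main (b : R) : L <= b%:E -> Lambda_sup le mu t (EFin \o h) <= b%:E.
  move=> Lb; apply/lee_addgt0Pr => e e0.
  rewrite -EFinD -lne_leP//.
  have e30 : (0 < e / 3)%R by rewrite divr_gt0.
  have := @net_limsup_mupow_exp_le h c b _ upperJ t_cvg0 hcont hc e30.
  have -> : (e / 3 *+ 3 = e)%R by lra.
  by apply => x; exact: le_trans Lb.
case: L hJL main => [r| |] _ main; [exact: main|by rewrite leey|].
(* For [L = -oo], [main] applies to every real: [0] rules out the value [+oo], and the value minus
   [1] rules out a finite one. *)
move: (main 0%R (leNye _)).
move: (main (fine (Lambda_sup le mu t (EFin \o h)) - 1)%R (leNye _)).
by case: (Lambda_sup _ _ _ _) => [r| |]//=; rewrite lee_fin lerBrDl gerDr ler10.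
Qed.

End varadhan.
End exponential_integrals.

(** * Separating classes and peaking test functions *)

Section separation.
Context {R : realType} {X : ptopologicalType}.
Implicit Types (A P : set (X -> R)) (K : set X) (x : X) (a : R).

(** Points without disjoint neighbourhoods have equal images under any continuous real function, [R]
    being Hausdorff. This later makes compact sets closed. *)
Lemma separates_points_hausdorff A : A `<=` continuous_functions ->
  separates_points A -> hausdorff_space X.
Proof.
move=> Acont sepA p q pq; apply: contrapT => /sepA[h Ah]; apply.
apply: (@Rhausdorff R) => U V hU hV.
have [z [Uz Vz]] := pq _ _ (Acont h Ah p _ hU) (Acont h Ah q _ hV).
by exists (h z).
Qed.

(** The open sets where some [f] in [P] exceeds [a] cover [K]; directedness provides one element of
    [P] above the finitely many functions of a subcover. *)
Lemma compact_directed_ge P K a : P `<=` continuous_functions -> P !=set0 ->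
  (forall f g, P f -> P g ->
    exists2 k, P k & forall z, (f z <= k z)%R /\ (g z <= k z)%R) ->
  compact K -> (forall y, K y -> exists2 f, P f & (a < f y)%R) ->
  exists2 f, P f & forall y, K y -> (a <= f y)%R.
Proof.
move=> Pcont [f0 Pf0] Pdir; rewrite compact_cover => cK Ka.
have [|y Ky|D DP KD] := cK _ P (fun f => f @^-1` `]a, +oo[%classic).
- by move=> f Pf; apply: open_comp => // z _; exact: Pcont.
- by have [f Pf af] := Ka y Ky; exists f => //=; rewrite in_itv/= af.
suff [k Pk Dk] : exists2 k, P k & forall f, f \in finmap.enum_fset D ->
    forall z, (f z <= k z)%R.
  exists k => // y /KD[f /= fD]; rewrite in_itv/= andbT => /ltW/le_trans.
  by apply; exact: Dk.
have : forall f, f \in finmap.enum_fset D -> P f by move=> f fD; apply/set_mem/DP.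
elim: (finmap.enum_fset D) => [_|f s IH sP]; first by exists f0.
have [|k Pk sk] := IH; first by move=> g gs; apply: sP; rewrite inE gs orbT.
have [||m Pm fkm] := Pdir f k => //; first by apply: sP; rewrite mem_head.
exists m => // g; rewrite inE => /predU1P[->|/sk gk] z; first by have [] := fkm z.
by rewrite (le_trans (gk z)) //; have [] := fkm z.
Qed.

(** All that the tight case requires of a class at [x], common to algebras and well-separating
    classes. *)
Definition peaks_at A x : Prop := forall K a, compact K -> ~ K x ->
  exists2 h, A h & forall y, (h y <= h x)%R /\ (K y -> (h y <= h x - a)%R).

(** Nonnegative elements vanishing at [x] are directed, since a sum dominates its summands; a square
    [g * g], scaled to be [|a| + 1] at [y], exceeds [a] there. *)
Lemma algebra_square_peak A K x a : real_algebra A ->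
  A `<=` continuous_functions -> compact K ->
  (forall y, K y -> exists2 g, A g & g x = 0%R /\ g y <> 0%R) ->
  exists2 s, A s /\ s x = 0%R &
    forall y, (0 <= s y)%R /\ (K y -> (a <= s y)%R).
Proof.
move=> [A0 AD AZ AM] Acont cK sepK.
have [||f g [Af [fx f0]] [Ag [gx g0]]||y Ky|s [As [sx s0]] sK] :=
    @compact_directed_ge [set s | A s /\ s x = 0%R /\ forall y, (0 <= s y)%R] K a.
- by move=> s [/Acont].
- by exists (cst 0%R).
- exists (f \+ g)%R => [|z]; last by rewrite lerDl lerDr.
  by split; [exact: AD|split=> [|z]/=; [rewrite fx gx addr0|rewrite addr_ge0]].
- by [].
- have [g Ag [gx /eqP gy]] := sepK y Ky.
  have gy0 : (0 < g y * g y)%R by rewrite -expr2 exprn_even_gt0.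
  exists ((`|a| + 1) / (g y * g y) \*o (g \* g))%R => /=.
    split; first by apply: AZ; exact: AM.
    split=> [|z]; first by rewrite gx !mulr0.
    by rewrite mulr_ge0 ?divr_ge0 ?addr_ge0 ?(ltW gy0)// -expr2 sqr_ge0.
  by rewrite mulfVK ?gt_eqF// (le_lt_trans (ler_norm a))// ltrDl.
by exists s => // y; split=> // /sK.
Qed.

(** Constants may be missing from [A], so [f - f x] is replaced by [f * (f - f x)], or by
    [f x * u - u x * f] when [f y = 0]. *)
Lemma algebra_separates_nonvanishing A x y : real_algebra A ->
  separates_points A -> x <> y -> (exists2 u, A u & u y <> 0%R) ->
  exists2 g, A g & g x = 0%R /\ g y <> 0%R.
Proof.
move=> [A0 AD AZ AM] sepA xy [u Au uy].
have [f Af fxy] := sepA x y xy.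
have [fy0|fy0] := pselect (f y = 0%R).
  exists (f x \*o u \+ - u x \*o f)%R; first by apply: AD; exact: AZ.
  rewrite /= fy0 mulr0 addr0 mulrC mulNr subrr; split=> //.
  by move=> /eqP; rewrite mulf_eq0 => /orP[/eqP fx|/eqP//]; apply: fxy; rewrite fx fy0.
exists (f \* f \+ - f x \*o f)%R; first by apply: AD; [exact: AM|exact: AZ].
rewrite /= !mulNr subrr -mulrBl; split=> // /eqP.
by rewrite mulf_eq0 subr_eq0 => /orP[/eqP fyx|/eqP//]; apply: fxy; rewrite fyx.
Qed.

Lemma algebra_peaks_nonpositive A x : real_algebra A ->
  A `<=` continuous_functions ->
  (forall y, x <> y -> exists2 g, A g & g x = 0%R /\ g y <> 0%R) ->
  peaks_at (nonpositive_part A) x.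
Proof.
move=> algA Acont sepx K a cK Kx.
have [y Ky|s [As sx] sP] := algebra_square_peak A K x a algA Acont cK.
  by apply: sepx => xy; apply: Kx; rewrite xy.
have [_ _ AZ _] := algA.
exists (-1 \*o s)%R => [|y] /=.
  split; first exact: AZ.
  by move=> y; rewrite /= mulN1r oppr_le0; have [] := sP y.
rewrite sx mulr0 sub0r mulN1r oppr_le0 lerN2; exact: sP.
Qed.

(** The cases are whether or not [A] has a common zero other than [x]; as [A] separates points,
    there is at most one. *)
Lemma algebra_peaks A x : real_algebra A -> A `<=` continuous_functions ->
  separates_points A -> peaks_at A x.
Proof.
move=> algA Acont sepA.
have [sepx|] := pselect (forall y, x <> y -> exists2 g, A g & g x = 0%R /\ g y <> 0%R).
  move=> K a cK Kx.
  have [h [Ah _]] := algebra_peaks_nonpositive A x algA Acont sepx K a cK Kx.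
  by exists h.
(* Otherwise all of [A] vanishes at some [y0]; pick [u] in [A] with [u x = 1]
   and take [h = 2 |a| (1 - (1 - u)^2 - s)], which lies in [A] although [1] may
   not: [(1 - u)^2] is large near [y0], and the sum of squares [s] elsewhere. *)
move=> /existsNP[y0 /not_implyP[xy0 noty0]].
have Ay0 u : A u -> u y0 = 0%R.
  move=> Au; apply: contrapT => uy0; apply: noty0.
  by apply: algebra_separates_nonvanishing => //; exists u.
have sepx y : x <> y -> y <> y0 -> exists2 g, A g & g x = 0%R /\ g y <> 0%R.
  move=> xy yy0; apply: algebra_separates_nonvanishing => //.
  by have [f Af] := sepA y y0 yy0; rewrite (Ay0 f)//; exists f.
have [A0 AD AZ AM] := algA.
have [f Af] := sepA x y0 xy0; rewrite (Ay0 f)// => /eqP fx.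
move=> K a cK Kx.
pose u := ((f x)^-1 \*o f)%R.
have Au : A u by exact: AZ.
have ux : u x = 1%R by rewrite /u /= mulVf.
(* [C] avoids [y0], where [(1 - u) ^+ 2] is [1]; thus [s] need only reach [1 / 2] on the part of [K]
   inside [C]. *)
pose C := u @^-1` [set r | (1 - r) ^+ 2 <= 2^-1]%R.
have cC : closed C.
  apply: preimage_closed => [y _|]; first exact: Acont.
  apply: (@preimage_closed R R (fun r => (1 - r) ^+ 2)%R [set r | r <= 2^-1]%R).
    move=> r _; apply: (@continuous_comp R R R (fun r => 1 - r)%R (fun r => r ^+ 2)%R).
      by apply: cvgB; [exact: cvg_cst|exact: cvg_id].
    exact: exprn_continuous.
  exact: closed_le.
have [y [Ky Cy]|s [As sx] sP] := algebra_square_peak A _ x 2^-1 algA Acont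
    (compact_closedI cK cC).
  apply: sepx => [xy|yy0]; first by apply: Kx; rewrite xy.
  by move: Cy; rewrite /C /= yy0 Ay0// subr0 expr1n; lra.
(* The drop from [x] to [y] is [2 * |a| * ((1 - u y) ^+ 2 + s y)], at least [|a|] once the last
   factor is at least [1 / 2]. *)
exists (2 * `|a| \*o ((2 \*o u \+ -1 \*o (u \* u)) \+ -1 \*o s))%R => [|y] /=.
  by apply/AZ/AD; [apply: AD; [exact: AZ|exact/AZ/AM]|exact: AZ].
rewrite [(u x)%R]ux sx; have [s0 sK] := sP y.
have a0 := normr_ge0 a; have la := ler_norm a.
have u1 := sqr_ge0 (1 - u y)%R.
split=> [|Ky]; first by nra.
suff : (2^-1 <= (1 - u y) ^+ 2 + s y)%R by nra.
have [Cy|] := pselect (C y); first by rewrite (le_trans (sK _)) ?lerDr//.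
by rewrite /C /= => /negP; rewrite -ltNge => /ltW/le_trans; apply; rewrite lerDl.
Qed.

Lemma well_separating_separates A : well_separating A -> separates_points A.
Proof.
move=> [_ _ sepA] x y xy; have [g Ag [gx gy]] := sepA x y 0%R 1%R xy.
by exists g => //; rewrite gx gy => /eqP; rewrite eq_sym oner_eq0.
Qed.

(** After a change of sign, minima become maxima, which direct the negatives of nonpositive elements
    vanishing at [x]; a minimum with the constant [0] makes a separating element nonpositive. *)
Lemma well_separating_peaks_nonpositive A x : A `<=` continuous_functions ->
  well_separating A -> peaks_at (nonpositive_part A) x.
Proof.
move=> Acont [Ac Amin sepA] K a cK Kx.
pose P := [set s | nonpositive_part A (- s)%R /\ s x = 0%R].
have Pcont : P `<=` continuous_functions.
  by move=> s [[/Acont sc _] _] z; rewrite -(opprK s); apply: continuousN; exact: sc.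
have [|f g [[Af f0] fx] [[Ag g0] gx]||y Ky|s [[As s0] sx] sK] :=
    @compact_directed_ge P K a Pcont.
- by exists (cst 0%R); split=> //; split=> [|z]; rewrite ?opp_cst ?oppr0//; exact: Ac.
- exists (f \max g)%O => [|z]; last by rewrite /= !le_max !lexx orbT.
  split; last by rewrite /= fx gx maxxx.
  have -> : (- (f \max g)%O = ((- f)%R \min (- g)%R)%O)%R.
    by apply/funext => z; exact: oppr_max.
  by split=> [|z]; [exact: Amin|rewrite /= ge_min f0].
- by [].
- have [g Ag [gx gy]] : exists2 g, A g & g x = 0%R /\ g y = (- (`|a| + 1))%R.
    by apply: sepA => xy; apply: Kx; rewrite xy.
  exists (- (g \min cst 0%R)%O)%R => /=.
    split; last by rewrite fctE /= gx minxx oppr0.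
    by rewrite opprK; split=> [|z]; [exact: Amin|rewrite /= ge_min lexx orbT].
  rewrite fctE /= gy min_l ?opprK ?oppr_le0 ?addr_ge0//.
  by rewrite (le_lt_trans (ler_norm a))// ltrDl.
exists (- s)%R => // y; rewrite !fctE sx oppr0 sub0r lerN2; split=> //.
  exact: s0.
exact: sK.
Qed.

End separation.

(** * The rate function satisfies the large deviation principle *)

Section rate_function.
Context {R : realType} {X : ptopologicalType} {I : Type} {le : I -> I -> Prop}.
Variables (mu : I -> probability (borel X) R) (t : I -> R).
Hypothesis le_dir : directed le.
Hypothesis t_gt0 : forall a, (0 < t a)%R.
Hypothesis t_cvg0 : t @ tails le --> (0 : R)%R.
Implicit Types (J l : X -> \bar R) (A S : set (X -> R)).

Lemma sup_expN_ge0 l (B : set X) : 0 <= sup_expN l B.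
Proof. by apply: ereal_sup_ubound; left. Qed.

(** The upper bound passes to [J] because [J <= l]. For the lower bound, a constant below [l] on an
    open set is also below [J] there. *)
Lemma lower_regularization_ldp l J : ldp le mu t l ->
  lower_regularization l J -> ldp le mu t J.
Proof.
move=> [l0 upper lower] [Jlsc Jl Jmax]; split.
- apply: Jmax => // x a a0; exists setT => //; exact: filterT.
- move=> F /upper/le_trans; apply; apply: ge_ereal_sup => _ [->|[x Fx <-]].
    exact: sup_expN_ge0.
  apply: (@le_trans _ _ (expeR (- J x))); first by rewrite lee_expeR leeN2.
  by apply: ereal_sup_ubound; right; exists x.
move=> G oG; apply: le_trans (lower G oG).
apply: ge_ereal_sup => _ [->|[x Gx <-]]; first exact: sup_expN_ge0.
rewrite le_lneP ?sup_expN_ge0// leeNl.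
set b := - lne _.
have bl y : G y -> b <= l y.
  move=> Gy; rewrite leeNl -le_lneP ?sup_expN_ge0//.
  by apply: ereal_sup_ubound; right; exists y.
suff : Order.max (J x) (if x \in G then b else -oo) <= J x.
  by rewrite mem_set// ge_max => /andP[].
(* Raising [J] to [b] on the open set [G] keeps it lower semicontinuous and below [l], so maximality
   of [J] applies. *)
apply: (Jmax (fun y => Order.max (J y) (if y \in G then b else -oo))) => [y a|y].
- rewrite lt_max => /orP[/Jlsc[V Vy VJ]|].
    by exists V => // z Vz; rewrite lt_max VJ.
  case: ifPn => // /set_mem Gy ab; exists G.
    by apply: open_nbhs_nbhs.
  by move=> z Gz; rewrite lt_max mem_set// ab orbT.
- rewrite ge_max Jl/=; case: ifPn => [/set_mem/bl//|_]; exact: leNye.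
Qed.

(** * Existence of [Lambda] and the conjugate formulas *)

Section conjugates.
Variable J : X -> \bar R.
Hypothesis J_lsc : lower_semicontinuous J.
Hypothesis J_ldp : ldp le mu t J.

(** The lower bound at each [x], truncating at [h x + 1], gives [h x - J x <= Lambda_inf h]; the
    upper bound with [L] equal to [Lambda_inf h] then closes the gap. *)
Lemma Lambda_exists_eq_sup (h : X -> R) (c : R) : continuous h ->
  (forall x, h x <= c)%R ->
  Lambda_exists le mu t (EFin \o h) /\
  Lambda le mu t (EFin \o h) = Lambda_sup le mu t (EFin \o h).
Proof.
move=> hcont hc; have [J0 upper lower] := J_ldp.
have tails_filter := tails_proper_filter le_dir.
have cvgh : mupow_exp mu t (EFin \o h) @ tails le -->
    net_limsup le (mupow_exp mu t (EFin \o h)).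
  apply: net_cvg => //; rewrite -lee_lne; last 2 first.
  - by rewrite in_itv/= leey andbT; apply: net_limsup_ge0 => // a; exact: poweR_ge0.
  - by rewrite in_itv/= leey andbT; apply: net_liminf_ge0 => // a; exact: poweR_ge0.
  apply: (Lambda_sup_le mu t le_dir t_gt0 J h c _ upper t_cvg0 hcont hc) => x.
  apply: le_trans (Lambda_inf_truncated_ge mu t le_dir t_gt0 J h x
    (h x + 1)%R lower hcont _) _.
    by rewrite ltrDl.
  by apply: le_Lambda_inf => // y; rewrite /truncated; case: ifP => // _; exact: leNye.
split; first by apply/cvg_ex; exists (net_limsup le (mupow_exp mu t (EFin \o h))).
by congr lne; apply/cvg_lim.
Qed.

Lemma Lambda_inf_trunc_nondecreasing (h : X -> \bar R) :
  nondecreasing_fun (fun M => Lambda_inf le mu t (truncated h M)).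
Proof.
move=> M N MN; apply: le_Lambda_inf => // x; rewrite /truncated.
case: ifPn => [hM|_]; last exact: leNye.
by rewrite (lt_le_trans hM).
Qed.

Lemma Lambda_inf_trunc_ge (h : X -> R) x : continuous h ->
  (h x)%:E - J x <= Lambda_inf_trunc le mu t (EFin \o h).
Proof.
move=> hcont; have [_ _ lower] := J_ldp.
apply: lime_ge.
  by apply: nondecreasing_is_cvge; exact: Lambda_inf_trunc_nondecreasing.
apply: filterS (nbhs_pinfty_gt (num_real (h x))) => M hM.
exact: Lambda_inf_truncated_ge.
Qed.

Lemma Lambda_inf_trunc_le (h : X -> \bar R) :
  Lambda_inf_trunc le mu t h <= Lambda_inf le mu t h.
Proof.
apply: lime_le.
  by apply: nondecreasing_is_cvge; exact: Lambda_inf_trunc_nondecreasing.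
apply: nearW => M; apply: le_Lambda_inf => // x; rewrite /truncated.
by case: ifP => // _; exact: leNye.
Qed.

Lemma le_conjugate_on A S (L L' : (X -> \bar R) -> \bar R) x : A `<=` S ->
  (forall h, A h -> L' (EFin \o h) <= L (EFin \o h)) ->
  conjugate_on A L x <= conjugate_on S L' x.
Proof.
move=> AS LL'; apply: ge_ereal_sup => _ [h Ah <-].
apply: (@le_trans _ _ ((h x)%:E - L' (EFin \o h))).
  by rewrite leeD2l// leeN2 LL'.
by apply: ereal_sup_ubound; exists h => //; exact: AS.
Qed.

(** The four suprema increase in the order listed, so it suffices to bound the first below and the
    last above by [J x]. A peak at height [b] yields [Lambda h <= h x - b]. *)
Lemma conjugate_on_eq S A x :
  S `<=` A -> A `<=` continuous_functions ->
  (forall h, S h -> exists c : R, forall y, (h y <= c)%R) ->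
  (forall a : R, a%:E < J x ->
    exists2 h, S h & forall y, (h y)%:E - J y <= (h x - a)%:E) ->
  [/\ J x = conjugate_on S (Lambda le mu t) x,
      J x = conjugate_on A (Lambda_sup le mu t) x,
      J x = conjugate_on A (Lambda_inf le mu t) x
    & J x = conjugate_on A (Lambda_inf_trunc le mu t) x].
Proof.
move=> SA Acont Sbnd peak; have [J0 upper _] := J_ldp.
have Lsup h : S h -> Lambda le mu t (EFin \o h) = Lambda_sup le mu t (EFin \o h).
  move=> Sh; have [c hc] := Sbnd h Sh.
  by have [] := Lambda_exists_eq_sup h c (Acont h (SA h Sh)) hc.
have c1 : J x <= conjugate_on S (Lambda le mu t) x.
  rewrite leNgt; apply/negP => cJ.
  (* A supremum equal to [-oo] is replaced by the real [-1], which is below [J x] as [J] is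
     nonnegative. *)
  have [a ca aJ] : exists2 a : R, conjugate_on S (Lambda le mu t) x <= a%:E & a%:E < J x.
    move: cJ; case: (conjugate_on _ _ _) => [r| |] rJ.
    - by exists r.
    - by move: rJ; rewrite ltNge leey.
    - by exists (-1)%R; [exact: leNye|rewrite (lt_le_trans _ (J0 x))// lte_fin ltrN10].
  have [b ab bJ] : exists2 b : R, (a < b)%R & b%:E < J x.
    move: aJ; case: (J x) => [r| |]//; rewrite ?lte_fin => ar.
    - by exists ((a + r) / 2)%R; [rewrite midf_lt|rewrite lte_fin midf_lt].
    - by exists (a + 1)%R; rewrite ?ltry ?ltrDl.
  have [h Sh hb] := peak b bJ; have [c hc] := Sbnd h Sh.
  have := Lambda_sup_le mu t le_dir t_gt0 J h c _ upper t_cvg0 (Acont h (SA h Sh)) hc hb.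
  rewrite -Lsup// => Lb.
  have : b%:E <= a%:E.
    apply: le_trans ca; apply: le_trans (ereal_sup_ubound _); last by exists h.
    apply: (@le_trans _ _ ((h x)%:E - (h x - b)%:E)).
      by rewrite -EFinB lee_fin; lra.
    by rewrite leeD2l// leeN2.
  by rewrite lee_fin leNgt ab.
have c2 : conjugate_on S (Lambda le mu t) x <= conjugate_on A (Lambda_sup le mu t) x.
  by apply: le_conjugate_on => // h /Lsup ->.
have c3 : conjugate_on A (Lambda_sup le mu t) x <= conjugate_on A (Lambda_inf le mu t) x.
  by apply: le_conjugate_on => // h _; exact: Lambda_inf_le_sup.
have c4 : conjugate_on A (Lambda_inf le mu t) x <=
    conjugate_on A (Lambda_inf_trunc le mu t) x.
  by apply: le_conjugate_on => // h _; exact: Lambda_inf_trunc_le.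
have c5 : conjugate_on A (Lambda_inf_trunc le mu t) x <= J x.
  apply: ge_ereal_sup => _ [h Ah <-].
  by rewrite -lee_subl_swap//; apply: Lambda_inf_trunc_ge; exact: Acont.
have c12 := le_trans c1 c2; have c13 := le_trans c12 c3.
have c14 := le_trans c13 c4; have c35 := le_trans c4 c5.
have c25 := le_trans c3 c35; have c15 := le_trans c2 c25.
by split; apply/le_anti/andP; split.
Qed.

(** Where [J > a], nonpositivity of [h] suffices; elsewhere [h] equals [- |a|] and [J >= 0]. *)
Lemma completely_regular_peak x (a : R) : completely_regular_space X ->
  a%:E < J x ->
  exists2 h, nonpositive_part continuous_functions h &
    forall y, (h y)%:E - J y <= (h x - a)%:E.
Proof.
move=> crX aJ; have [J0 _ _] := J_ldp.
have oU : open [set y | a%:E < J y] by move/lower_semicontinuousP : J_lsc; apply.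
have [f [fcont f01 f0 f1]] : exists f : X -> R, [/\ continuous f,
    range f `<=` `[0%R, 1%R]%classic, f @` [set x] `<=` [set 0%R] &
    f @` (~` [set y | a%:E < J y]) `<=` [set 1%R]].
  apply/uniform_separatorP; apply: crX; first exact: open_closedC.
  by apply.
have fx : f x = 0%R by apply: f0; exists x.
exists (fun y => - `|a| * f y)%R.
  split=> [y|y]; first by apply: cvgM; [exact: cvg_cst|exact: fcont].
  have /= : `[0%R, 1%R]%classic (f y) by apply: f01; exists y.
  by rewrite in_itv/= => /andP[fy0 _]; rewrite mulNr oppr_le0 mulr_ge0.
move=> y; rewrite fx mulr0 sub0r.
have /= : `[0%R, 1%R]%classic (f y) by apply: f01; exists y.
rewrite in_itv/= => /andP[fy0 _].
have afy : (- `|a| * f y <= 0)%R by rewrite mulNr oppr_le0 mulr_ge0.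
have [aJy|aJy] := pselect (a%:E < J y).
  by move: aJy; case: (J y) => [r| |]//; rewrite ?lte_fin ?leNye ?lee_fin//; lra.
have -> : f y = 1%R by apply: f1; exists y.
rewrite mulr1; apply: (@le_trans _ _ (- `|a|)%:E).
  by rewrite geeDl// leeNl oppe0.
by rewrite lee_fin lerN2 ler_norm.
Qed.

Lemma exponentially_tight_peak S x (a : R) : exponentially_tight le mu t ->
  hausdorff_space X -> peaks_at S x -> a%:E < J x ->
  exists2 h, S h & forall y, (h y)%:E - J y <= (h x - a)%:E.
Proof.
move=> tight hX peak aJ; have [J0 _ lower] := J_ldp.
have [K cK Ka] := tight _ (expR_gt0 (- a)).
have oU : open [set y | a%:E < J y] by move/lower_semicontinuousP : J_lsc; apply.
have oK : open (~` K) by apply: closed_openC; exact: compact_closed.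
(* The complement of [K] is open, so the lower bound gives [expeR (- J y) < expR (- a)] for [y] in
   it. *)
have JK y : ~ K y -> a%:E <= J y.
  move=> Ky; rewrite -[J y]oppeK leeNr -lee_expeR -[leRHS]/(expR (- a))%:E.
  apply/ltW; apply: le_lt_trans Ka; apply: le_trans (le_net_liminf_limsup le_dir _).
  apply: le_trans (lower _ oK).
  by apply: ereal_sup_ubound; right; exists y.
(* This compact set misses [x] because [J x > a]. *)
have [||h Sh hP] := peak (K `&` ~` [set y | a%:E < J y]) a.
- by apply: compact_closedI => //; exact: open_closedC.
- by case=> _; apply.
exists h => // y; have [hyx hK] := hP y.
have key : a%:E <= J y -> (h y)%:E - J y <= (h x - a)%:E.
  by case: (J y) => [r| |]//; rewrite ?leNye ?lee_fin//; lra.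
have [/ltW//|aJy] := pselect (a%:E < J y).
have [Ky|/JK//] := pselect (K y).
apply: (@le_trans _ _ (h y)%:E); first by rewrite geeDl// leeNl oppe0.
by rewrite lee_fin hK.
Qed.

End conjugates.
End rate_function.

(** * The formulas over all continuous functions and over separating classes *)

Theorem corollary1 (R : realType) (X : ptopologicalType) (I : Type)
    (le : I -> I -> Prop) (mu : I -> probability (borel X) R) (t : I -> R)
    (J : X -> \bar R) :
  (exists x y : X, x <> y) ->
  (forall K : set X, compact K -> measurable (K : set (borel X))) ->
  directed le ->
  (forall a, (0 < t a)%R) ->
  t @ tails le --> (0 : R)%R ->
  completely_regular_space X ->
  ldp_rate_function le mu t J ->
  [/\ forall h, nonpositive_part continuous_functions h ->
        Lambda_exists le mu t (EFin \o h),
      forall x, J x = conjugate_on (nonpositive_part continuous_functions)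
                        (Lambda le mu t) x,
      forall x, J x = conjugate_on continuous_functions
                        (Lambda_sup le mu t) x,
      forall x, J x = conjugate_on continuous_functions
                        (Lambda_inf le mu t) x
    & forall x, J x = conjugate_on continuous_functions
                        (Lambda_inf_trunc le mu t) x]
  /\
  (exponentially_tight le mu t ->
   forall A : set (X -> R), A `<=` continuous_functions ->
   (real_algebra A /\ separates_points A) \/ well_separating A ->
   [/\ forall h, bounded_above_part A h -> Lambda_exists le mu t (EFin \o h),
       forall x, J x = conjugate_on (bounded_above_part A)
                         (Lambda le mu t) x,
       forall x, J x = conjugate_on A (Lambda_inf le mu t) x,
       forall x, J x = conjugate_on A (Lambda_inf_trunc le mu t) x
     & vanishes_nowhere A ->
       forall x, J x = conjugate_on (nonpositive_part A)
                         (Lambda le mu t) x]).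
Proof.
move=> _ _ le_dir t_gt0 t_cvg0 crX [l l_ldp lJ].
have J_ldp := lower_regularization_ldp mu t l J l_ldp lJ.
have [J_lsc _ _] := lJ.
have LP := Lambda_exists_eq_sup mu t le_dir t_gt0 t_cvg0 J J_ldp.
have conjP := conjugate_on_eq mu t le_dir t_gt0 t_cvg0 J J_ldp.
split.
  have eqs x := conjP _ continuous_functions x (fun h => @proj1 _ _)
    (fun _ => id) (fun h hS => ex_intro _ 0%R hS.2)
    (fun a => completely_regular_peak mu t J J_lsc J_ldp x a crX).
  split=> [h [hcont h0]|x|x|x|x]; first exact: (LP h 0%R hcont h0).1.
  - by have [] := eqs x.
  - by have [] := eqs x.
  - by have [] := eqs x.
  - by have [] := eqs x.
move=> tight A Acont classA.
have sepA : separates_points A.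
  by case: classA => [[]|/well_separating_separates].
have hX := separates_points_hausdorff A Acont sepA.
have peakP S x (a : R) :=
  exponentially_tight_peak mu t le_dir J J_lsc J_ldp S x a tight hX.
have eqs x := conjP (bounded_above_part A) A x (fun h => @proj1 _ _) Acont
  (fun h hS => hS.2).
have peakA x : peaks_at (bounded_above_part A) x.
  move=> K a cK Kx.
  have [h Ah hP] : exists2 h, A h &
      forall y, (h y <= h x)%R /\ (K y -> (h y <= h x - a)%R).
    case: classA => [[algA _]|wsA]; first exact: algebra_peaks.
    have [h [Ah _] hP] :=
      well_separating_peaks_nonpositive A x Acont wsA K a cK Kx.
    by exists h.
  (* A peaking function is bounded above by its value at the peak. *)
  by exists h => //; split=> //; exists (h x) => y; have [] := hP y.
split=> [h [Ah [c hc]]|x|x|x|Anv x]; first exact: (LP h c (Acont h Ah) hc).1.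
- by have [] := eqs x (fun a => peakP _ x a (peakA x)).
- by have [] := eqs x (fun a => peakP _ x a (peakA x)).
- by have [] := eqs x (fun a => peakP _ x a (peakA x)).
(* Only the algebra case draws on [Anv]: it excludes common zeros, so minus a sum of squares peaks
   at [x]. *)
have peakN : peaks_at (nonpositive_part A) x.
  case: classA => [[algA _]|wsA]; last exact: well_separating_peaks_nonpositive.
  apply: algebra_peaks_nonpositive => // y xy.
  exact: algebra_separates_nonvanishing.
by have [] := conjP (nonpositive_part A) A x (fun h => @proj1 _ _) Acont
  (fun h hS => ex_intro _ 0%R hS.2) (fun a => peakP _ x a peakN).
Qed.
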